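(* Let $k\ge 1$ be an integer and let $q$, $a_0$, $t$, $K$ be real numbers with $0<q\le k$, $a_0>0$, $t>1$ and $K>0$. There exists a constant $c>0$, depending only on $k,q,a_0,t,K$, such that the following holds. Let $\mathcal H$ be a $k$-uniform hypergraph on a vertex set $\Gamma$ with $|\Gamma|=N\ge 1$, let $0<p<1$, put $\mu=|\mathcal H|p^k$, and suppose that (i) $|\mathcal H|/N^q\ge a_0$; (ii) for all integers $j$ with $0\le j\le q$, $\Delta_j\le K N^{q-j}$; (iii) for all integers $j$ with $q<j\le k$, $\Delta_j\le K$; (iv) $C>0$ is a real number for which there exists $\Gamma_0\subseteq\Gamma$ such that $|\Gamma_0|\le C\mu^{1/q}$ and $|\mathcal H[\Gamma_0]|\ge t\mu$. Then, with $X=|\mathcal H[\Gamma_p]|$, $$\mathbb P(X\ge t\mu)\le\exp\left\{-c\max\left(\mu^{1/q}p^{k(1/\lfloor q\rfloor-1/q)},\ \mu^{1/\lceil q\rceil}\right)\right\}$$ and $$\mathbb P(X\ge t\mu)\ge p^{C\mu^{1/q}}=\exp\{-C\mu^{1/q}\log(1/p)\}.$$ Here, when $q<1$ (so $\lfloor q\rfloor=0$), the term $\mu^{1/q}p^{k(1/\lfloor q\rfloor-1/q)}$ is interpreted as $0$.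
   Context: A $k$-uniform hypergraph $\mathcal H$ on a finite vertex set $\Gamma$ is identified with its set of edges, which are $k$-element subsets of $\Gamma$; $|\mathcal H|$ is the number of edges. For $\Gamma'\subseteq\Gamma$, $\mathcal H[\Gamma']$ denotes the set of edges of $\mathcal H$ contained in $\Gamma'$. $\Gamma_p$ is the random (binomial) subset of $\Gamma$ which includes each element of $\Gamma$ independently with probability $p$. Thus $X=|\mathcal H[\Gamma_p]|$ counts the edges of $\mathcal H$ entirely present in $\Gamma_p$, and $\mathbb E X=|\mathcal H|p^k=\mu$. For $j=0,1,\dots,k$, $\Delta_j=\max_{S\subseteq\Gamma,\,|S|=j}|\{T\in\mathcal H: T\supseteq S\}|$ is the maximum number of edges containing $j$ given vertices. *)

(* Defs.v *)
From HB Require Import structures.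
From mathcomp Require Import all_boot all_order all_algebra.
From mathcomp Require Import all_classical all_reals all_analysis.

Set Implicit Arguments.
Unset Strict Implicit.
Unset Printing Implicit Defensive.

Import Order.TTheory GRing.Theory Num.Theory.

Local Open Scope ring_scope.

(* A hypergraph is its set of edges H : {set {set T}}; the ambient vertex set
   is the whole finite type T. *)
Section Hypergraph.
Variable T : finType.
Implicit Types (H : {set {set T}}) (A S : {set T}).

Definition k_uniform (k : nat) H : Prop := forall e, e \in H -> #|e| = k.

Definition induced_edges H A : {set {set T}} := [set e in H | e \subset A].

(* The maximum is over the j-element sets S of vertices, and is 0 when there
   are none, i.e., when j > #|T|. *)
Definition max_degree (j : nat) H : nat :=
  \max_(S : {set T} | #|S| == j) #|[set e in H | S \subset e]|.

End Hypergraph.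

Section BinomialSubset.
Variables (R : realType) (T : finType).

(* Law of the binomial random subset of T: by independence, the probability of
   the outcome A is a product over the elements of T. *)
Definition binomial_subset_pmf (p : R) (A : {set T}) : R :=
  \prod_(x : T) (if x \in A then p else 1 - p).

Definition binomial_subset_prob (p : R) (E : pred {set T}) : R :=
  \sum_(A : {set T} | E A) binomial_subset_pmf p A.

Definition upper_tail (H : {set {set T}}) (p x : R) : R :=
  binomial_subset_prob p (fun A => x <= #|induced_edges H A|%:R).

End BinomialSubset.

Section Exponent.
Variable R : realType.

Definition floor_term (k : nat) (q mu p : R) : R :=
  if q < 1 then 0
  else mu `^ (1 / q) * p `^ (k%:R * (1 / (Num.floor q)%:~R - 1 / q)).

Definition ceil_term (q mu : R) : R := mu `^ (1 / (Num.ceil q)%:~R).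

End Exponent.

(* Main.v *)
Require Import Defs.
From HB Require Import structures.
From mathcomp Require Import all_boot all_order all_algebra.
From mathcomp Require Import all_classical all_reals all_analysis.
From mathcomp Require Import ring lra.

Set Implicit Arguments.
Unset Strict Implicit.
Unset Printing Implicit Defensive.

Import Order.TTheory GRing.Theory Num.Theory.

Local Open Scope ring_scope.

(** The lower bound is the probability p ^ |Gamma0| that the random set contains
    Gamma0, an event on which X >= t mu ([upper_tail_ge_superset]).

    The upper bound is Markov's inequality for a high moment X ^ m.  Expanding
    E X ^ m as a sum over m-tuples of edges and revealing the edges one by one,
    each new edge e costs p ^ |e \ V|, where V is the union of the previous edges
    and has at most k (m - 1) vertices.  So if
      sum_e p ^ |e \ V| <= lam   whenever |V| <= L,
    then E X ^ m <= lam ^ m as long as k (m - 1) <= L, and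
    P (X >= t mu) <= (lam / (t mu)) ^ m  ([upper_tail_le_moment]).

    The edges disjoint from V contribute at most mu to that sum.  The edges
    meeting V in at least j >= 1 vertices number at most
    L ^ i Delta_i for every i <= j ([card_edges_meeting]), so the rest is a small
    fraction of mu provided that, for some threshold s,
      L ^ j Delta_j << |H| p ^ j  for 0 < j < s,  and  L ^ s Delta_s << |H| p ^ k,
    taking i = min (j, s) ([sum_edge_weight_le]).  Then lam < t mu with
    a ratio depending only on t, and m of order L gives exp (- c L).

    Since |H| is of order N ^ q, the bound Delta_j <= K N ^ (q - j) turns the
    conditions for 0 < j < s into L << N p.  Both expressions in the maximum are
    O(N p) and admissible values of L up to a small constant factor:
    s = ceil q works for mu ^ (1 / ceil q) ([ceil_scale]), because then
    Delta_s <= K and L ^ s << mu; and s = floor q works for the other one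
    ([floor_scale]), which is of order N p ^ (k / floor q). *)

(** * Moments of the number of induced edges *)

Lemma leq_bin_exp (n i : nat) : ('C(n, i) <= n ^ i)%N.
Proof.
apply: (@leq_trans (n ^_ i)); first by rewrite -bin_ffact leq_pmulr ?fact_gt0.
elim: i => [|i IHi]; first by rewrite ffactn0.
by rewrite ffactnSr expnSr leq_mul ?leq_subr.
Qed.

Section Moments.
Variables (R : realType) (T : finType) (p : R) (H : {set {set T}}).
Implicit Types (A S U V e : {set T}).
Hypotheses (p_ge0 : 0 <= p) (p_le1 : p <= 1).

Lemma binomial_subset_pmf_ge0 A : 0 <= binomial_subset_pmf p A.
Proof. by apply: prodr_ge0 => x _; case: ifP; rewrite ?subr_ge0. Qed.

(** The product of the factors p (on U) and p + (1 - p) (off U), expanded over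
    all subsets. *)
Lemma sum_pmf_superset U :
  \sum_(A : {set T} | U \subset A) binomial_subset_pmf p A = p ^+ #|U|.
Proof.
(* The factor for the choice of x outside A vanishes on U, which kills exactly
   the sets A that do not contain U. *)
pose G x : R := if x \in U then 0 else 1 - p.
have -> : p ^+ #|U| = \prod_(x : T) (p + G x).
  rewrite (bigID (mem U)) /= [X in _ * X]big1 ?mulr1.
    rewrite (eq_bigr (fun=> p)) => [|x xU]; first by rewrite prodr_const.
    by rewrite /G xU addr0.
  by move=> x /negbTE xU; rewrite /G xU addrC subrK.
rewrite bigA_distr big_mkcond /=; apply: eq_bigr => A _.
case: ifPn => [UA|/fintype.subsetPn[x xU xA]].
  apply: eq_bigr => x _; case: ifPn => // xA.
  by rewrite /G ifN //; apply: contra xA; apply: (fintype.subsetP UA).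
by rewrite (bigD1 x) //= (negbTE xA) /G xU mul0r.
Qed.

(** Restricting E X ^ m to the event that a given set U is present makes an
    induction on m possible: one factor X is a sum over edges e, and requiring
    e to be present replaces U by its union with e.  The size of U
    grows by at most k for each of the m factors; the slack k on the right
    accounts for the last edge, whose addition needs no further bound. *)
Lemma sum_pmf_moment (k m : nat) (L lam : R) U :
  0 <= lam -> (forall e, e \in H -> (#|e| <= k)%N) ->
  (forall V, #|V|%:R <= L -> \sum_(e in H) p ^+ #|e :\: V| <= lam) ->
  #|U|%:R + (k * m)%:R <= L + k%:R ->
  \sum_(A : {set T} | U \subset A)
     binomial_subset_pmf p A * #|induced_edges H A|%:R ^+ m
    <= p ^+ #|U| * lam ^+ m.
Proof.
move=> lam0 Hk Hlam; elim: m U => [|m IHm] U sizeU.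
  rewrite expr0 mulr1 -sum_pmf_superset; apply/ler_sum => A _.
  by rewrite expr0 mulr1.
have -> : \sum_(A : {set T} | U \subset A)
     binomial_subset_pmf p A * #|induced_edges H A|%:R ^+ m.+1
  = \sum_(e in H) \sum_(A : {set T} | e :|: U \subset A)
     binomial_subset_pmf p A * #|induced_edges H A|%:R ^+ m.
  rewrite (exchange_big_dep (fun A => U \subset A)) /=; last first.
    by move=> e A _; rewrite finset.subUset => /andP[].
  apply: eq_bigr => A UA; rewrite sumr_const exprSr mulrA mulr_natr.
  congr (_ *+ _); apply: eq_card => e.
  by rewrite [RHS]unfold_in finset.subUset UA andbT inE.
apply: (@le_trans _ _ (\sum_(e in H) p ^+ #|e :|: U| * lam ^+ m)).
  apply: ler_sum => e eH; apply: IHm; apply: le_trans sizeU.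
  rewrite mulnS natrD addrA lerD2r -natrD ler_nat addnC.
  by apply: leq_trans (leq_card_setU e U) _; rewrite leq_add2r Hk.
rewrite -mulr_suml exprS mulrA ler_wpM2r ?exprn_ge0 //.
have -> : \sum_(e in H) p ^+ #|e :|: U|
        = p ^+ #|U| * \sum_(e in H) p ^+ #|e :\: U|.
  rewrite mulr_sumr; apply: eq_bigr => e _; rewrite -exprD; congr (_ ^+ _).
  rewrite -(cardsID U (e :|: U)) finset.setDUl finset.setDv finset.setU0.
  by rewrite finset.setIC finset.setKU.
rewrite ler_wpM2l ?exprn_ge0 // Hlam //.
have : (k <= k * m.+1)%N by rewrite mulnS leq_addr.
rewrite -(ler_nat R) => kk.
by rewrite -(lerD2r k%:R); apply: le_trans sizeU; rewrite lerD2l.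
Qed.

Lemma upper_tail_le_moment (k m : nat) (L lam x : R) :
  0 <= lam -> 0 < x -> (forall e, e \in H -> (#|e| <= k)%N) ->
  (forall V, #|V|%:R <= L -> \sum_(e in H) p ^+ #|e :\: V| <= lam) ->
  (k * m)%:R <= L + k%:R ->
  upper_tail H p x <= (lam / x) ^+ m.
Proof.
move=> lam0 x0 Hk Hlam Hm; rewrite expr_div_n ler_pdivlMr ?exprn_gt0 //.
have := @sum_pmf_moment k m L lam finset.set0 lam0 Hk Hlam.
rewrite cards0 add0r expr0 mul1r => /(_ Hm); apply: le_trans.
rewrite /upper_tail /binomial_subset_prob mulr_suml big_mkcond /=.
rewrite [leRHS](eq_bigl xpredT) => [|A]; last by rewrite finset.sub0set.
apply: ler_sum => A _; case: ifP => [xA|_].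
  by rewrite ler_wpM2l ?binomial_subset_pmf_ge0 // lerXn2r ?nnegrE // ltW.
by rewrite mulr_ge0 ?exprn_ge0 // binomial_subset_pmf_ge0.
Qed.

Lemma upper_tail_ge_superset U (x : R) :
  x <= #|induced_edges H U|%:R -> p ^+ #|U| <= upper_tail H p x.
Proof.
move=> xU; rewrite -sum_pmf_superset /upper_tail /binomial_subset_prob.
rewrite big_mkcond [leRHS]big_mkcond; apply: ler_sum => A _.
case: ifP => [UA|_]; last by case: ifP => // _; apply: binomial_subset_pmf_ge0.
rewrite ifT //; apply: le_trans xU _; rewrite ler_nat; apply: subset_leq_card.
apply/fintype.subsetP => e; rewrite !inE => /andP[-> eU] /=.
exact: fintype.subset_trans eU UA.
Qed.

(** Each such edge contains an i-element subset of U, of which there are at most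
    |U| ^ i. *)
Lemma card_edges_meeting (i : nat) U :
  (#|[set e in H | i <= #|e :&: U|]| <= #|U| ^ i * max_degree i H)%N.
Proof.
pose D := [set S : {set T} | S \subset U & #|S| == i].
apply: (@leq_trans (#|D| * max_degree i H)); last first.
  by rewrite leq_mul2r cards_draws leq_bin_exp orbT.
apply: (@leq_trans #|\bigcup_(S in D) [set e in H | S \subset e]|).
  apply/subset_leq_card/fintype.subsetP => e; rewrite inE => /andP[eH ieU].
  have : [set S : {set T} | S \subset e :&: U & #|S| == i] != finset.set0.
    by rewrite -card_gt0 cards_draws bin_gt0.
  case/set0Pn => S; rewrite inE finset.subsetI => /andP[/andP[Se SU] Si].
  by apply/finset.bigcupP; exists S; rewrite !inE ?SU ?eH.
rewrite -sum_nat_const.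
apply: (big_ind2 (fun (B : {set {set T}}) n => #|B| <= n)%N) => [|B m C n Bm Cn|S].
- by rewrite cards0.
- by apply: leq_trans (leq_card_setU B C) _; rewrite leq_add.
rewrite inE => /andP[_ Si]; rewrite /max_degree.
by rewrite (bigD1 S) //= leq_maxl.
Qed.

(** An edge has weight p ^ (k - j) with j its number of vertices in U.  The term
    mu pays for j = 0, and each of the k values j > 0 contributes at most eps mu:
    the number of edges is bounded through i = j below the threshold s, and
    through i = s, with p ^ (k - j) <= 1, from s on. *)
Lemma sum_edge_weight_le (k s : nat) (L eps : R) U :
  (forall e, e \in H -> #|e| = k) -> 0 <= eps ->
  (forall j, (j < s)%N -> (0 < j)%N ->
     L ^+ j * (max_degree j H)%:R <= eps * (#|H|%:R * p ^+ j)) ->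
  L ^+ s * (max_degree s H)%:R <= eps * (#|H|%:R * p ^+ k) ->
  #|U|%:R <= L ->
  \sum_(e in H) p ^+ #|e :\: U| <= (1 + k%:R * eps) * (#|H|%:R * p ^+ k).
Proof.
move=> Hk eps0 Hlow Hs UL; set mu := _ * _ ^+ k.
pose N j := #|[set e in H | (j <= #|e :&: U|)%N]|.
have Nle i j : (i <= j)%N -> (N j)%:R <= L ^+ i * (max_degree i H)%:R.
  move=> ij; apply: (@le_trans _ _ (#|U| ^ i * max_degree i H)%:R).
    rewrite ler_nat; apply: leq_trans (card_edges_meeting i U).
    apply/subset_leq_card/fintype.subsetP => e; rewrite !inE => /andP[-> /=].
    exact: leq_trans.
  by rewrite natrM natrX ler_wpM2r // lerXn2r ?nnegrE // (le_trans _ UL).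
have term j : (0 < j <= k)%N -> p ^+ (k - j) * (N j)%:R <= eps * mu.
  case/andP=> j0 jk; have [js|sj] := ltnP j s.
    have -> : eps * mu = p ^+ (k - j) * (eps * (#|H|%:R * p ^+ j)).
      by rewrite /mu -{1}(subnK jk) exprD; ring.
    by rewrite ler_wpM2l ?exprn_ge0 //; apply: le_trans (Hlow _ js j0); apply: Nle.
  apply: le_trans Hs; apply: le_trans (Nle _ _ sj).
  by rewrite ler_piMl // exprn_ile1.
(* Counting an edge once for every j up to |e :&: U| is wasteful, but keeps
   the count N j monotone in j. *)
apply: (@le_trans _ _ (\sum_(e in H) (p ^+ k +
   \sum_(j < k | (j.+1 <= #|e :&: U|)%N) p ^+ (k - j.+1)))).
  apply: ler_sum => e eH.
  have eD : (k - #|e :&: U|)%N = #|e :\: U| by rewrite cardsD (Hk _ eH).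
  have := subset_leq_card (finset.subsetIl e U); rewrite (Hk e) // => eUk.
  have [e0|e0] := posnP #|e :&: U|.
    by rewrite -eD e0 subn0 lerDl sumr_ge0 // => j _; rewrite exprn_ge0.
  have ltk : (#|e :&: U|.-1 < k)%N by rewrite prednK.
  rewrite (bigD1 (Ordinal ltk)) /= ?prednK // eD addrCA lerDl addr_ge0 ?exprn_ge0 //.
  by apply: sumr_ge0 => j _; rewrite exprn_ge0.
rewrite big_split /= sumr_const -[_ *+ #|H|]mulr_natl -/mu mulrDl mul1r lerD2l.
rewrite (exchange_big_dep xpredT) //= -mulrA.
apply: (@le_trans _ _ (\sum_(j < k) eps * mu)); last first.
  by rewrite sumr_const card_ord mulr_natl.
apply: ler_sum => j _; apply: le_trans (term j.+1 _); last by rewrite /= ltn_ord.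
rewrite sumr_const -[leLHS]mulr_natr /N ler_wpM2l ?exprn_ge0 // ler_nat.
by apply/subset_leq_card/fintype.subsetP => e; rewrite !inE.
Qed.
End Moments.

(** With m the least integer exceeding L / k, the unions met in the moment
    argument have at most k (m - 1) <= L vertices, while m >= L / k is large enough
    for the exponent. *)
Lemma upper_tail_le_expR (R : realType) (T : finType) (H : {set {set T}})
    (k s : nat) (p L eps t : R) :
  0 < p -> p <= 1 -> (0 < k)%N -> k_uniform k H -> (0 < #|H|)%N ->
  0 < eps -> 1 + k%:R * eps < t -> 0 <= L ->
  (forall j, (j < s)%N -> (0 < j)%N ->
     L ^+ j * (max_degree j H)%:R <= eps * (#|H|%:R * p ^+ j)) ->
  L ^+ s * (max_degree s H)%:R <= eps * (#|H|%:R * p ^+ k) ->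
  upper_tail H p (t * (#|H|%:R * p ^+ k)) <=
    expR (- (ln (t / (1 + k%:R * eps)) / k%:R * L)).
Proof.
move=> p0 p1 k0 Hk H0 eps0 epst L0 Hlow Hs; set mu := _ * _ ^+ k.
have mu0 : 0 < mu by rewrite mulr_gt0 ?exprn_gt0 ?ltr0n.
have kR : 0 < k%:R :> R by rewrite ltr0n.
have lam0 : 0 < 1 + k%:R * eps by rewrite ltr_pwDl // mulr_ge0 // ltW.
have t0 : 0 < t by apply: lt_trans epst.
set r := (1 + k%:R * eps) / t.
have r0 : 0 < r by rewrite divr_gt0.
have r1 : r <= 1 by rewrite ler_pdivrMr // mul1r ltW.
have -> : t / (1 + k%:R * eps) = r^-1 by rewrite invf_div.
pose m := (Num.trunc (L / k%:R)).+1.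
have Lk0 : 0 <= L / k%:R by rewrite divr_ge0 // ltW.
have /andP[m1 m2] := truncn_itv Lk0.
apply: (@le_trans _ _ (r ^+ m)).
  have -> : r = (1 + k%:R * eps) * mu / (t * mu) by rewrite /r; field; rewrite !gt_eqF.
  apply: (@upper_tail_le_moment _ _ _ _ (ltW p0) p1 k m L).
  - exact: ltW (mulr_gt0 lam0 mu0).
  - by rewrite mulr_gt0.
  - by move=> e /Hk ->.
  - by move=> V; apply: sum_edge_weight_le (ltW eps0) Hlow Hs; rewrite // ?ltW.
  rewrite /m mulnS natrD natrM addrC lerD2r.
  by rewrite mulrC -ler_pdivlMr.
rewrite lnV ?posrE // -[r in r ^+ _]lnK ?posrE // -expRM_natr ler_expR.
rewrite !mulNr opprK -mulrA mulrC [leRHS]mulrC ler_wnM2r ?ln_le0 //.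
by rewrite mulrC ltW.
Qed.

(** * Admissible scales under the degree conditions *)

Lemma card_le_max_degree0 (T : finType) (H : {set {set T}}) :
  (#|H| <= max_degree 0 H)%N.
Proof.
rewrite /max_degree (bigD1 finset.set0) ?cards0 //=.
apply: leq_trans (leq_maxl _ _); apply/subset_leq_card/fintype.subsetP => e eH.
by rewrite inE eH finset.sub0set.
Qed.

Section Scales.
Variables (R : realType) (T : finType) (H : {set {set T}}).
Variables (k : nat) (q a0 K K1 p : R).
Local Notation N := (#|T|%:R : R).
Local Notation mu := (#|H|%:R * p ^+ k).
Hypotheses (k_gt0 : (0 < k)%N) (q_gt0 : 0 < q) (q_lek : q <= k%:R).
Hypotheses (a0_gt0 : 0 < a0) (K_gt0 : 0 < K) (K1_ge1 : 1 <= K1) (K_leK1 : K <= K1).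
Hypotheses (T_gt0 : (0 < #|T|)%N) (H_unif : k_uniform k H).
Hypotheses (p_gt0 : 0 < p) (p_le1 : p <= 1).
Hypothesis (H_dense : a0 * N `^ q <= #|H|%:R).
Hypothesis degree_low : forall j : nat, j%:R <= q ->
  (max_degree j H)%:R <= K * N `^ (q - j%:R).
Hypothesis degree_high : forall j : nat, q < j%:R -> (j <= k)%N ->
  (max_degree j H)%:R <= K.

Let N_ge1 : 1 <= N. Proof. by rewrite ler1n. Qed.
Let N_gt0 : 0 < N. Proof. by rewrite ltr0n. Qed.
Let Nq_gt0 : 0 < N `^ q. Proof. exact: powR_gt0. Qed.

Lemma card_edges_gt0 : (0 < #|H|)%N.
Proof. by rewrite -(ltr0n R); apply: lt_le_trans H_dense; rewrite mulr_gt0. Qed.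

Lemma card_edges_le : #|H|%:R <= K * N `^ q.
Proof.
have := @degree_low 0 (ltW q_gt0); rewrite subr0; apply: le_trans.
by rewrite ler_nat card_le_max_degree0.
Qed.

Lemma powR_split_nat j : N `^ q = N ^+ j * N `^ (q - j%:R).
Proof.
rewrite -powR_mulrn ?ltW // -powRD; first by rewrite addrC subrK.
by rewrite (gt_eqF N_gt0) implybT.
Qed.

(** For w = p ^ j and B <= K1 N p this is the condition on small j; for
    w = p ^ k it is also the condition at the threshold s = floor q.  As
    N ^ q = N ^ j N ^ (q - j), the powers of N cancel; the smallness of delta K1
    survives the j-th power because j > 0. *)
Lemma degree_step (delta eps B w : R) j :
  0 <= delta -> delta * K1 <= 1 -> delta * K1 * K <= eps * a0 -> (0 < j)%N ->
  j%:R <= q -> 0 <= w -> 0 <= B -> B ^+ j <= (K1 * N) ^+ j * w ->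
  (delta * B) ^+ j * (max_degree j H)%:R <= eps * (#|H|%:R * w).
Proof.
move=> d0 dK1 dKa j0 jq w0 B0 Bj.
have dK0 : 0 <= delta * K1 by rewrite mulr_ge0 // (le_trans ler01).
have e0 : 0 <= eps.
  by rewrite -(pmulr_lge0 _ a0_gt0); apply: le_trans dKa; rewrite mulr_ge0 // ltW.
have dj : (delta * K1) ^+ j <= delta * K1.
  by rewrite -[leRHS]expr1; apply: ler_wiXn2l.
apply: (@le_trans _ _ (delta ^+ j * ((K1 * N) ^+ j * w) * (K * N `^ (q - j%:R)))).
  rewrite exprMn ler_pM ?mulr_ge0 ?exprn_ge0 ?degree_low //.
  by rewrite ler_wpM2l ?exprn_ge0.
have -> : delta ^+ j * ((K1 * N) ^+ j * w) * (K * N `^ (q - j%:R))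
        = (delta * K1) ^+ j * K * (N `^ q * w).
  by rewrite (powR_split_nat j) !exprMn; ring.
apply: (@le_trans _ _ (eps * a0 * (N `^ q * w))).
  rewrite ler_wpM2r ?mulr_ge0 ?powR_ge0 //; apply: le_trans dKa.
  by rewrite ler_wpM2r // ltW.
by rewrite -mulrA ler_wpM2l // mulrA ler_wpM2r.
Qed.

Lemma upper_tail_scale (t eps delta B : R) (s : nat) :
  0 < eps -> 1 + k%:R * eps < t ->
  0 <= delta -> delta * K1 <= 1 -> delta * K1 * K <= eps * a0 ->
  0 <= B -> B <= K1 * N * p -> (forall j, (j < s)%N -> j%:R <= q) ->
  (delta * B) ^+ s * (max_degree s H)%:R <= eps * mu ->
  upper_tail H p (t * mu) <=
    expR (- (ln (t / (1 + k%:R * eps)) / k%:R * delta * B)).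
Proof.
move=> e0 et d0 dK1 dKa B0 BN sq Hs; rewrite -mulrA.
apply: (@upper_tail_le_expR _ _ _ k s) => //.
- exact: card_edges_gt0.
- by rewrite mulr_ge0.
move=> j js j0; apply: degree_step => //; rewrite ?sq ?exprn_ge0 ?(ltW p_gt0) //.
by rewrite -exprMn lerXn2r ?nnegrE // (le_trans B0).
Qed.

(** At the threshold s = ceil q the degree is bounded by K, also when q is an
    integer, and the s-th power of the scale is exactly mu.  The comparison with
    N p uses q <= s and s <= k. *)
Lemma ceil_scale (delta eps : R) :
  0 <= delta <= 1 -> delta * K <= eps ->
  let s := `|Num.ceil q|%N in
  [/\ ceil_term q mu <= K1 * N * p,
      (forall j, (j < s)%N -> j%:R <= q) &
      (delta * ceil_term q mu) ^+ s * (max_degree s H)%:R <= eps * mu].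
Proof.
move=> /andP[d0 d1] dK s.
have sE : (Num.ceil q)%:~R = s%:R :> R.
  by rewrite pmulrn /s gez0_abs // ceil_ge0 (lt_trans _ q_gt0) ?oppr_lt0.
have qs : q <= s%:R by rewrite -sE ceil_ge.
have s0 : (0 < s)%N by rewrite -(ltr0n R) (lt_le_trans q_gt0).
have sk : (s <= k)%N.
  rewrite -(ler_nat R) -sE (_ : k%:R = (Posz k)%:~R) //.
  by rewrite ler_int ceil_le_int.
have mu0 : 0 <= mu by rewrite mulr_ge0 // exprn_ge0 // ltW.
have powS : ceil_term q mu ^+ s = mu.
  rewrite -powR_mulrn ?powR_ge0 // /ceil_term -powRrM sE.
  by rewrite mul1r mulVf ?powRr1 // pnatr_eq0 -lt0n.
split.
- have K10 : 0 <= K1 by apply: le_trans K1_ge1.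
  rewrite -(ler_pXn2r s0) ?nnegrE ?powR_ge0 ?mulr_ge0 ?(ltW p_gt0) //.
  rewrite powS exprMn ler_pM ?exprn_ge0 ?(ltW p_gt0) //; last first.
    by rewrite ler_wiXn2l // ltW.
  apply: (le_trans card_edges_le).
  rewrite exprMn ler_pM ?powR_ge0 ?(ltW K_gt0) //.
    by apply: (le_trans K_leK1); rewrite ler_eXnr.
  by rewrite -powR_mulrn ?ler_powR // ltW.
- move=> j js; rewrite leNgt; apply/negP => qj.
  have : (Num.ceil q <= j%:Z)%R by rewrite ceil_le_int ltW.
  by rewrite -(ler_int R) sE ler_nat leqNgt js.
rewrite exprMn powS mulrAC ler_wpM2r //; apply: le_trans dK.
apply: ler_pM; rewrite ?exprn_ge0 //.
  by rewrite -[leRHS]expr1 ler_wiXn2l.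
have [qls|sq] := ltP q s%:R; first exact: degree_high.
have := degree_low sq; rewrite (_ : s%:R = q) ?subrr ?powRr0 ?mulr1 //.
by apply/eqP; rewrite eq_le sq.
Qed.

(** Writing mu = |H| p ^ k, the powers of p combine into p ^ (k / floor q), so the
    scale is |H| ^ (1 / q) p ^ (k / floor q) with |H| ^ (1 / q) <= K1 N. *)
Lemma floor_scale (delta eps : R) :
  1 <= q -> 0 <= delta -> delta * K1 <= 1 -> delta * K1 * K <= eps * a0 ->
  let s := `|Num.floor q|%N in
  [/\ floor_term k q mu p <= K1 * N * p,
      (forall j, (j < s)%N -> j%:R <= q) &
      (delta * floor_term k q mu p) ^+ s * (max_degree s H)%:R <= eps * mu].
Proof.
move=> q1 d0 dK1 dKa s.
have sE : (Num.floor q)%:~R = s%:R :> R.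
  by rewrite pmulrn /s gez0_abs // floor_ge0 ltW.
have sq : s%:R <= q by rewrite -sE floor_le.
have s0 : (0 < s)%N by rewrite absz_gt0 gt_eqF // floor_gt0.
have sR : 0 < s%:R :> R by rewrite ltr0n.
have sk : s%:R <= k%:R :> R by apply: le_trans q_lek.
have [p0 h0] : 0 <= p /\ 0 <= #|H|%:R :> R by split=> //; apply: ltW.
have KN0 : 0 <= K1 * N by rewrite mulr_ge0 ?(le_trans ler01 K1_ge1).
have BE : floor_term k q mu p = #|H|%:R `^ (1 / q) * p `^ (k%:R / s%:R).
  rewrite /floor_term ltNge q1 /= sE powRM ?exprn_ge0 // -mulrA; congr (_ * _).
  rewrite -powR_mulrn // -powRrM -powRD ?(gt_eqF p_gt0) ?implybT //; congr (_ `^ _).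
  by rewrite mulrBr !mul1r addrC subrK.
have hN : #|H|%:R `^ (1 / q) <= K1 * N.
  apply: (@le_trans _ _ ((K * N `^ q) `^ (1 / q))).
    by rewrite ge0_ler_powR ?nnegrE ?divr_ge0 ?mulr_ge0 ?powR_ge0 ?card_edges_le
      ?(ltW q_gt0) ?(ltW K_gt0).
  rewrite powRM ?powR_ge0 ?(ltW K_gt0) // -powRrM mul1r divff ?gt_eqF //.
  rewrite powRr1 // ler_wpM2r //; apply: (@le_trans _ _ (K1 `^ q^-1)).
    by rewrite ge0_ler_powR ?nnegrE ?invr_ge0 ?(le_trans ler01 K1_ge1)
      ?(ltW q_gt0) ?(ltW K_gt0).
  by rewrite ler1_powR // invf_le1.
have pk : p `^ (k%:R / s%:R) ^+ s = p ^+ k.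
  rewrite -powR_mulrn ?powR_ge0 // -powRrM divfK ?powR_mulrn // gt_eqF //.
rewrite BE; split.
- rewrite ler_pM ?powR_ge0 // ge1r_powR ?p_gt0 //.
  by rewrite ler_pdivlMr // mul1r.
- by move=> j js; apply: le_trans sq; rewrite ler_nat ltnW.
apply: degree_step; rewrite ?exprn_ge0 ?mulr_ge0 ?powR_ge0 //.
rewrite exprMn pk ler_wpM2r ?exprn_ge0 // lerXn2r ?nnegrE ?powR_ge0 //.
Qed.
End Scales.

(** * The tail bounds *)

Theorem theorem2p2 (R : realType) (k : nat) (q a0 t K : R)
    (hk : (1 <= k)%N) (hq0 : 0 < q) (hqk : q <= k%:R)
    (ha0 : 0 < a0) (ht : 1 < t) (hK : 0 < K) :
  exists c : R, 0 < c /\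
    forall (T : finType) (H : {set {set T}}) (p C : R),
      let mu := #|H|%:R * p ^+ k in
      (1 <= #|T|)%N ->
      k_uniform k H ->
      0 < p -> p < 1 ->
      a0 <= #|H|%:R / #|T|%:R `^ q ->
      (forall j : nat, j%:R <= q ->
         (max_degree j H)%:R <= K * #|T|%:R `^ (q - j%:R)) ->
      (forall j : nat, q < j%:R -> (j <= k)%N -> (max_degree j H)%:R <= K) ->
      0 < C ->
      (exists Gamma0 : {set T},
         #|Gamma0|%:R <= C * mu `^ (1 / q) /\
         t * mu <= #|induced_edges H Gamma0|%:R) ->
      upper_tail H p (t * mu) <=
        expR (- (c * Num.max (floor_term k q mu p) (ceil_term q mu))) /\
      p `^ (C * mu `^ (1 / q)) <= upper_tail H p (t * mu) /\
      p `^ (C * mu `^ (1 / q)) = expR (- (C * mu `^ (1 / q) * ln (1 / p))).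
Proof.
have kR : 0 < k%:R :> R by rewrite ltr0n.
(* K1 dominates both 1 and K, hence also all their roots.  The choice of eps
   puts 1 + k eps halfway between 1 and t. *)
pose K1 := 1 + K; pose eps := (t - 1) / (2 * k%:R).
have K1_ge1 : 1 <= K1 by rewrite lerDl ltW.
have K1_gt0 : 0 < K1 by apply: lt_le_trans K1_ge1.
have eps0 : 0 < eps by rewrite divr_gt0 ?subr_gt0 // mulr_gt0.
have ke : k%:R * eps = (t - 1) / 2 by rewrite /eps; field; rewrite gt_eqF.
have et : 1 + k%:R * eps < t by rewrite ke; lra.
pose delta := Num.min K1^-1 (Num.min (eps / K) (eps * a0 / (K1 * K))).
have d0 : 0 < delta.
  by rewrite /delta !lt_min invr_gt0 K1_gt0 (divr_gt0 eps0 hK)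
    (divr_gt0 (mulr_gt0 eps0 ha0) (mulr_gt0 K1_gt0 hK)).
have dK1 : delta * K1 <= 1 by rewrite -ler_pdivlMr // mul1r /delta ge_min lexx.
have dK : delta * K <= eps.
  by rewrite -ler_pdivlMr // /delta !ge_min lexx orbT.
have dKa : delta * K1 * K <= eps * a0.
  by rewrite -mulrA -ler_pdivlMr ?mulr_gt0 // /delta !ge_min lexx !orbT.
have d1 : delta <= 1.
  by apply: le_trans dK1; rewrite ler_peMr // ltW.
pose c := ln (t / (1 + k%:R * eps)) / k%:R * delta.
have c0 : 0 < c.
  rewrite mulr_gt0 // divr_gt0 // ln_gt0 // ltr_pdivlMr ?mul1r //.
  by rewrite ltr_pwDl // mulr_ge0 // ltW.
exists c; split=> // T H p C mu T0 Hk p0 p1 Ha low high C0 [U [Usize Uedges]].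
have Nq : 0 < (#|T|%:R : R) `^ q by rewrite powR_gt0 // ltr0n.
rewrite ler_pdivlMr // in Ha.
have KK1 : K <= K1 by rewrite lerDr.
have ceil_case : upper_tail H p (t * mu) <= expR (- (c * ceil_term q mu)).
  have [] := @ceil_scale R T H k q K K1 p hq0 hqk hK K1_ge1 KK1 T0 p0 (ltW p1)
    low high delta eps _ dK; first by rewrite ltW.
  move=> BN sq Hs; apply: (upper_tail_scale hk ha0 hK K1_ge1 T0 Hk p0 (ltW p1)
    Ha low eps0 et (ltW d0) dK1 dKa _ BN sq Hs).
  exact: powR_ge0.
have floor_case : upper_tail H p (t * mu) <= expR (- (c * floor_term k q mu p)).
  have [q1|q1] := ltP q 1.
    apply: le_trans ceil_case _; rewrite /floor_term q1 mulr0 oppr0.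
    by rewrite ler_expR oppr_le0 mulr_ge0 ?powR_ge0 // ltW.
  have [] := @floor_scale R T H k q a0 K K1 p hq0 hqk ha0 hK K1_ge1 KK1 T0 p0 (ltW p1)
    Ha low delta eps q1 (ltW d0) dK1 dKa.
  move=> BN sq Hs; apply: (upper_tail_scale hk ha0 hK K1_ge1 T0 Hk p0 (ltW p1)
    Ha low eps0 et (ltW d0) dK1 dKa _ BN sq Hs).
  by rewrite /floor_term ltNge q1 /= mulr_ge0 ?powR_ge0.
split; first by rewrite /Num.max; case: ifP.
have pE x : p `^ x = expR (- (x * ln (1 / p))).
  by rewrite /powR gt_eqF // div1r lnV ?posrE // mulrN opprK.
split; last exact: pE.
apply: le_trans (upper_tail_ge_superset (ltW p0) (ltW p1) Uedges).
rewrite -powR_mulrn ?(ltW p0) // !pE ler_expR lerN2 ler_wpM2r //.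
by rewrite ln_ge0 // ler_pdivlMr // mul1r ltW.
Qed.
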